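(* Let $P$ and $P'$ be projection algebras. Then for any projection algebra morphism $\phi:P\to P'$, there is a unique $*$-semigroup homomorphism $\overline\phi:\mathsf{PG}(P)\to\mathsf{PG}(P')$ such that $p\overline\phi=p\phi$ for all $p\in P$ (where $P$ and $P'$ are regarded as subsets of $\mathsf{PG}(P)$ and $\mathsf{PG}(P')$); and moreover any $*$-semigroup homomorphism $\mathsf{PG}(P)\to\mathsf{PG}(P')$ has the form $\overline\phi$ for some projection algebra morphism $\phi:P\to P'$.
   Context: Maps are written to the right of their arguments and composed left to right. A regular $*$-semigroup is a semigroup $S$ with a unary operation $a\mapsto a^*$ satisfying $(a^* )^*=a=aa^*a$ and $(ab)^*=b^*a^*$ for all $a,b\in S$. A $*$-semigroup homomorphism is a semigroup homomorphism $\phi$ with $(a^* )\phi=(a\phi)^*$. A projection algebra is a set $P$ with unary operations $\theta_p:P\to P$ ($p\in P$) such that for all $p,q\in P$: $p\theta_p=p$; $\theta_p\theta_p=\theta_p$; $p\theta_q\theta_p=q\theta_p$; $\theta_p\theta_q\theta_p=\theta_{q\theta_p}$; $\theta_p\theta_q\theta_p\theta_q=\theta_p\theta_q$. Morphisms are maps $\phi:P\to P'$ satisfying $(p\theta_q)\phi=(p\phi)\theta_{q\phi}$ for all $p,q\in P$. On a projection algebra $P$ define: $p\leq_{\mathscr F}q$ iff $p=q\theta_p$; and $p\mathrel{\mathscr F}q$ iff $p\leq_{\mathscr F}q$ and $q\leq_{\mathscr F}p$. A $P$-path is a tuple $(p_1,\ldots,p_k)\in P^k$ ($k\geq1$) with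 $p_1\mathrel{\mathscr F}\cdots\mathrel{\mathscr F}p_k$, regarded as a morphism $p_1\to p_k$. The path category $\mathscr P(P)$ has object set $P$, morphisms all $P$-paths, composition $(p_1,\ldots,p_k)\circ(p_k,\ldots,p_l)=(p_1,\ldots,p_k,\ldots,p_l)$, and identities $(p)$, identified with $p$. For $p\in P$, a pair $(e,f)\in P\times P$ is $p$-linked if $f=e\theta_p\theta_f$ and $e=f\theta_p\theta_e$; then $\lambda(e,p,f)=(e,e\theta_p,f)$ and $\rho(e,p,f)=(e,f\theta_p,f)$ are $P$-paths. Let $\equiv$ be the (category) congruence on $\mathscr P(P)$ generated by all pairs $((p,p),(p))$ with $p\in P$, all pairs $((p,q,p),(p))$ with $p\mathrel{\mathscr F}q$, and all pairs $(\lambda(e,p,f),\rho(e,p,f))$ with $p\in P$ and $(e,f)$ a $p$-linked pair. The $\equiv$-class of $(p_1,\ldots,p_k)$ is denoted $[\![p_1,\ldots,p_k]\!]$ (a reduced chain). The chain semigroup $\mathsf{PG}(P)$ is the regular $*$-semigroup of all reduced chains, with $[\![p_1,\ldots,p_k]\!]^*=[\![p_k,\ldots,p_1]\!]$ and $[\![p_1,\ldots,p_k]\!]\bullet[\![q_1,\ldots,q_l]\!]=[\![p_1',\ldots,p_k',q_1',\ldots,q_l']\!]$, where, with $p'=q_1\theta_{p_k}$ and $q'=p_k\theta_{q_1}$, $p_i'=p'\theta_{p_k}\cdots\theta_{p_i}$ and $q_j'=q'\theta_{q_1}\cdots\theta_{q_j}$. Each $p\in P$ is identified with $[\![p]\!]\in\mathsf{PG}(P)$.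 *)

(* Defs.v *)
From HB Require Import structures.
From mathcomp Require Import all_boot.
From mathcomp Require Import boolp.

Set Implicit Arguments.
Unset Strict Implicit.
Unset Printing Implicit Defensive.

Local Open Scope group_scope.
Local Open Scope quotient_scope.

HB.mixin Record Semigroup_isRegularStar S of Semigroup S := {
  star : S -> S;
  starK : involutive star;
  starM : forall a b : S, star (a * b) = star b * star a;
  mul_star_mul : forall a : S, a * star a * a = a
}.

#[short(type="regStarSemigroupType")]
HB.structure Definition RegularStarSemigroup :=
  { S of Semigroup_isRegularStar S & Semigroup S }.

Definition star_hom (S S' : regStarSemigroupType) (phi : S -> S') : Prop :=
  {morph phi : a b / a * b >-> a * b} /\ {morph phi : a / star a >-> star a}.

Reserved Notation "x \th_ p"
  (at level 40, left associativity, p at level 2, format "x  \th_ p").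

(* [theta p x] is the image of x under theta_p. Maps act on
   the right: [x \th_p \th_q] applies theta_p first. *)
HB.mixin Record isProjectionAlgebra P := {
  theta : P -> P -> P;
  thxx : forall p : P, theta p p = p;
  thK : forall p x : P, theta p (theta p x) = theta p x;
  thswap : forall p q : P, theta p (theta q p) = theta p q;
  thcomp : forall p q x : P,
    theta p (theta q (theta p x)) = theta (theta p q) x;
  th4 : forall p q x : P,
    theta q (theta p (theta q (theta p x))) = theta q (theta p x)
}.

#[short(type="projAlgType")]
HB.structure Definition ProjectionAlgebra := { P of isProjectionAlgebra P }.

Notation "x \th_ p" := (theta p x) : group_scope.

Definition proj_morphism (P P' : projAlgType) (phi : P -> P') : Prop :=
  forall p q : P, phi (p \th_q) = phi p \th_(phi q).

Section Paths.
Variable P : projAlgType.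
Implicit Types (p q e f t x y z u v w a b : P) (s : seq P).

Definition leF p q : Prop := p = q \th_p.
Definition relF p q : Prop := leF p q /\ leF q p.
Definition relFb : rel P := fun p q => `[< relF p q >].

Lemma relF_sym p q : relF p q -> relF q p.
Proof. by case. Qed.

Lemma relFbP p q : reflect (relF p q) (relFb p q).
Proof. exact: asboolP. Qed.

Lemma relFb_sym : symmetric relFb.
Proof. by move=> p q; apply/relFbP/relFbP => /relF_sym. Qed.

(* The P-path (p_1, ..., p_k) is stored as p_1 and the list of p_2, ..., p_k. *)
Record ppath := PPath {
  psrc : P;
  prest : seq P;
  ppathP : path relFb psrc prest
}.

Definition pseq (c : ppath) : seq P := psrc c :: prest c.
Definition ptgt (c : ppath) : P := last (psrc c) (prest c).

Lemma pseq_inj : injective pseq.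
Proof.
move=> [x s Hs] [y r Hr] [E1 E2]; case: _ / E1 in Hr *; case: _ / E2 in Hr *.
by rewrite (bool_irrelevance Hs Hr).
Qed.

Definition pid p : ppath := @PPath p [::] isT.

Lemma pcomp_subproof (c d : ppath) :
  ptgt c = psrc d -> path relFb (psrc c) (prest c ++ prest d).
Proof. by move=> E; rewrite cat_path ppathP -/(ptgt c) E ppathP. Qed.
Definition pcomp (c d : ppath) (E : ptgt c = psrc d) : ppath :=
  PPath (pcomp_subproof E).

Lemma prev_subproof (c : ppath) :
  path relFb (ptgt c) (rev (belast (psrc c) (prest c))).
Proof.
rewrite rev_path (eq_path (e' := relFb)) ?ppathP // => x y.
exact: relFb_sym.
Qed.
Definition prev (c : ppath) : ppath := PPath (prev_subproof c).

(* Concatenation of tuples (not composition of morphisms). *)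
Lemma pcat_subproof (c d : ppath) :
  relF (ptgt c) (psrc d) -> path relFb (psrc c) (prest c ++ pseq d).
Proof. by move=> /relFbP E; rewrite cat_path ppathP /= -/(ptgt c) E ppathP. Qed.
Definition pcat (c d : ppath) (E : relF (ptgt c) (psrc d)) : ppath :=
  PPath (pcat_subproof E).

Lemma pseq_prev c : pseq (prev c) = rev (pseq c).
Proof. by rewrite /pseq [X in rev X]lastI rev_rcons. Qed.

Lemma ptgtE c x : ptgt c = last x (pseq c).
Proof. by []. Qed.

Lemma ptgt_prev c : ptgt (prev c) = psrc c.
Proof. by rewrite (ptgtE _ (psrc c)) pseq_prev rev_cons last_rcons. Qed.

Lemma pseq_comp c d (E : ptgt c = psrc d) : pseq (pcomp E) = pseq c ++ prest d.
Proof. by []. Qed.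

Lemma thF x p q : relF p q -> relF (x \th_p) (x \th_p \th_q).
Proof.
move=> [Epq Eqp]; set t := x \th_p; have tp : t \th_p = t by rewrite thK.
split; rewrite /leF.
- have -> : t \th_q \th_t = q \th_t by rewrite thswap.
  by rewrite -[in q \th_t]tp -thcomp -Epq thswap tp.
- by rewrite -thcomp !thswap.
Qed.

(* [scanl thr t [:: q_1; ...; q_l]] lists the t theta_{q_1} ... theta_{q_j}. *)
Definition thr x p : P := x \th_p.

Lemma prestrict_subproof t (c : ppath) :
  path relFb (t \th_(psrc c)) (scanl thr (t \th_(psrc c)) (prest c)).
Proof.
case: c => p s /=; elim: s t p => //= q s IH t p /andP[/relFbP pq Hs].
apply/andP; split; first by apply/relFbP/thF.
exact: (IH (t \th_p)).
Qed.
Definition prestrict t (c : ppath) : ppath := PPath (prestrict_subproof t c).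

Lemma pseq_restrict t c : pseq (prestrict t c) = scanl thr t (pseq c).
Proof. by []. Qed.

Lemma last_scanl t s : last t (scanl thr t s) = foldl thr t s.
Proof. by elim: s t => //=. Qed.

Lemma ptgt_restrict t c : ptgt (prestrict t c) = foldl thr t (pseq c).
Proof. by rewrite (ptgtE _ t) -last_scanl. Qed.

Lemma foldl_ptgt t c : foldl thr t (pseq c) \th_(ptgt c) = foldl thr t (pseq c).
Proof.
by rewrite (ptgtE c t) /pseq lastI foldl_rcons last_rcons /thr thK.
Qed.

Lemma relF_meet p q : relF (q \th_p) (p \th_q).
Proof.
by split; rewrite /leF -thcomp !thswap.
Qed.

(* (p_1',...,p_k',q_1',...,q_l') with p' = q_1 theta_{p_k} and
   q' = p_k theta_{q_1}; the primed left part is computed backwards from p_k. *)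
Section Product.
Variables c d : ppath.
Definition pmulL : ppath := prev (prestrict (psrc d \th_(ptgt c)) (prev c)).
Definition pmulR : ppath := prestrict (ptgt c \th_(psrc d)) d.
Lemma pmul_subproof : relF (ptgt pmulL) (psrc pmulR).
Proof. by rewrite ptgt_prev /= !thK; apply: relF_meet. Qed.
Definition pmul : ppath := pcat pmul_subproof.
End Product.

Definition linked p e f : Prop :=
  f = e \th_p \th_f /\ e = f \th_p \th_e.

Lemma linked_sym p e f : linked p e f -> linked p f e.
Proof. by case. Qed.

Lemma linked_leF p e f : linked p e f -> p \th_e = e.
Proof.
case=> Ef Ee.
rewrite [in LHS]Ee -thcomp -thcomp thswap -/(theta f (theta p e)) -Ef.
by rewrite -Ee.
Qed.

Lemma linked_relF p e f : linked p e f -> relF e (e \th_p) /\ relF (e \th_p) f.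
Proof.
move=> H; have [Ef Ee] := H; split; split; rewrite /leF.
- by rewrite thswap (linked_leF H).
- by rewrite -thcomp !thswap.
- by rewrite -thcomp -Ee.
- exact: Ef.
Qed.

Lemma plink_subproof p e f :
  linked p e f -> path relFb e [:: e \th_p; f].
Proof. by move=> /linked_relF[/relFbP /= -> /relFbP ->]. Qed.
Lemma prho_subproof p e f :
  linked p e f -> path relFb e [:: f \th_p; f].
Proof.
move=> /linked_sym/linked_relF[/relF_sym/relFbP /= H /relF_sym/relFbP ->].
by rewrite H.
Qed.
Definition plambda p e f (H : linked p e f) : ppath :=
  PPath (plink_subproof H).
Definition prho p e f (H : linked p e f) : ppath :=
  PPath (prho_subproof H).

Lemma pdup_subproof p : path relFb p [:: p].
Proof. by rewrite /= andbT; apply/relFbP; split; rewrite /leF thxx. Qed.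
Definition pdup p : ppath := PPath (pdup_subproof p).

Lemma pbounce_subproof p q : relF p q -> path relFb p [:: q; p].
Proof. by move=> /relFbP H; rewrite /= H relFb_sym H. Qed.
Definition pbounce p q (H : relF p q) : ppath := PPath (pbounce_subproof H).

(* The congruence is inductively generated on morphisms of the path category;
   that congruent paths are parallel is a consequence ([pcong_ends]). *)
Inductive pcong : ppath -> ppath -> Prop :=
| pcong_dup p : pcong (pdup p) (pid p)
| pcong_bounce p q (H : relF p q) : pcong (pbounce H) (pid p)
| pcong_link p e f (H : linked p e f) : pcong (plambda H) (prho H)
| pcong_refl c : pcong c c
| pcong_sym c d : pcong c d -> pcong d c
| pcong_trans c d g : pcong c d -> pcong d g -> pcong c g
| pcong_comp c c' d d' (E : ptgt c = psrc d) (E' : ptgt c' = psrc d') :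
    pcong c c' -> pcong d d' -> pcong (pcomp E) (pcomp E').

Lemma pcong_ends c d : pcong c d -> psrc c = psrc d /\ ptgt c = ptgt d.
Proof.
elim=> //.
- by move=> {}c {}d _ [-> ->].
- by move=> {}c {}d g _ [-> ->] _ [-> ->].
- move=> {}c c' {}d d' E E' _ [Hc1 Hc2] _ [Hd1 Hd2]; split => //.
  rewrite /ptgt /= !last_cat -/(ptgt c) -/(ptgt c') E E'; exact: Hd2.
Qed.

Lemma pcong_eq c d c' d' :
  pseq c = pseq c' -> pseq d = pseq d' -> pcong c d -> pcong c' d'.
Proof. by move=> /pseq_inj <- /pseq_inj <-. Qed.

Lemma pcong_prev c d : pcong c d -> pcong (prev c) (prev d).
Proof.
elim=> {c d}.
- move=> p; apply: pcong_eq (pcong_dup p); by rewrite ?pseq_prev.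
- move=> p q H; apply: pcong_eq (pcong_bounce H); by rewrite ?pseq_prev.
- move=> p e f H.
  by apply: pcong_eq (pcong_sym (pcong_link (linked_sym H))); rewrite pseq_prev.
- by move=> c; apply: pcong_refl.
- by move=> c d _; apply: pcong_sym.
- by move=> c d g _ H _; apply: pcong_trans H.
- move=> c c' d d' E E' Hc IHc Hd IHd.
  have F : ptgt (prev d) = psrc (prev c) by rewrite ptgt_prev /= E.
  have F' : ptgt (prev d') = psrc (prev c') by rewrite ptgt_prev /= E'.
  have H c0 d0 (e0 : ptgt c0 = psrc d0) (f0 : ptgt (prev d0) = psrc (prev c0)) :
    pseq (pcomp f0) = pseq (prev (pcomp e0)).
    rewrite pseq_comp !pseq_prev pseq_comp rev_cat -(pseq_prev c0).
    by rewrite {1}/pseq rev_cons cat_rcons -e0.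
  by apply: pcong_eq (pcong_comp F F' IHd IHc).
Qed.

Lemma linked_restrict p e f t : linked p e f -> t \th_e = t ->
  [/\ linked p t (t \th_p \th_f), t \th_(e \th_p) = t \th_p
    & t \th_(f \th_p) = t \th_p \th_f \th_p].
Proof.
move=> H te; have [Ef Ee] := H; set u := t \th_p \th_f.
have Et : t = u \th_p \th_t.
  have Ht y : y \th_t = y \th_e \th_t \th_e by rewrite thcomp te.
  have Hy : u \th_p \th_e = t.
    by rewrite /u -{1}te (thcomp p f) thcomp -Ee.
  by rewrite Ht Hy thxx te.
split; last by rewrite -thcomp.
- split => //.
  by rewrite {2}/u -!thcomp -/u -Et.
- by rewrite -thcomp -{1}te th4 te.
Qed.

Lemma pcong_restrict t c d : pcong c d -> pcong (prestrict t c) (prestrict t d).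
Proof.
move=> H; elim: H t => {c d}.
- move=> p t; apply: pcong_eq (pcong_dup (t \th_p)); rewrite //.
  by rewrite pseq_restrict /= /thr thK.
- move=> p q H t.
  apply: pcong_eq (pcong_bounce (thF t H)); rewrite ?pseq_restrict //= /thr.
  by rewrite thcomp -(proj1 H).
- move=> p e f H t.
  have [L E1 E2] := linked_restrict H (thK e t).
  apply: pcong_eq (pcong_link L); rewrite ?pseq_restrict //= /thr.
  + by rewrite E1.
  + by rewrite E2 th4.
- by move=> c t; apply: pcong_refl.
- by move=> c d _ IH t; apply: pcong_sym.
- by move=> c d g _ IH1 _ IH2 t; apply: pcong_trans (IH1 t) (IH2 t).
- move=> c c' d d' E E' Hc IHc Hd IHd t.
  have F c0 d0 (E0 : ptgt c0 = psrc d0) :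
      ptgt (prestrict t c0) = psrc (prestrict (ptgt (prestrict t c0)) d0).
    by rewrite /= ptgt_restrict -E0 foldl_ptgt.
  have F' c0 d0 (E0 : ptgt c0 = psrc d0) :
      pseq (pcomp (F _ _ E0)) = pseq (prestrict t (pcomp E0)).
    rewrite pseq_comp !pseq_restrict pseq_comp scanl_cat /=.
    by rewrite -E0 ptgt_restrict foldl_ptgt.
  apply: pcong_eq (F' _ _ E) (F' _ _ E') _.
  apply: (pcong_comp _ _ (IHc t)).
  by rewrite (proj2 (pcong_ends (IHc t))).
Qed.

(* [eqv x s s'] : the P-paths x :: s and x :: s' are congruent. *)
Definition eqv x s s' :=
  exists (H : path relFb x s) (H' : path relFb x s'), pcong (PPath H) (PPath H').

Lemma pcong_eqv c d : psrc c = psrc d -> pcong c d <-> eqv (psrc c) (prest c) (prest d).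
Proof.
case: c d => [x s H] [y r H'] /= E; case: _ / E in H' *; split.
  by exists H, H'.
by case=> K [K']; rewrite (bool_irrelevance K H) (bool_irrelevance K' H').
Qed.

Lemma eqv_refl x s : path relFb x s -> eqv x s s.
Proof. by move=> H; exists H, H; apply: pcong_refl. Qed.

Lemma eqv_sym x s r : eqv x s r -> eqv x r s.
Proof. by case=> H [H' K]; exists H', H; apply: pcong_sym. Qed.

Lemma eqv_trans x s r r' : eqv x s r -> eqv x r r' -> eqv x s r'.
Proof.
case=> H [H' K] [L' [L'' M]]; exists H, L''; apply: pcong_trans K _.
by rewrite (bool_irrelevance H' L').
Qed.

Lemma eqv_last x s r : eqv x s r -> last x s = last x r.
Proof. by case=> H [H' /pcong_ends[]]. Qed.

Lemma eqv_comp x s s' r r' :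
  eqv x s s' -> eqv (last x s) r r' -> eqv x (s ++ r) (s' ++ r').
Proof.
move=> H; have E := eqv_last H; case: H => H [H' K] [L [L' M]].
have E' : ptgt (PPath H') = psrc (PPath L') by exact: esym E.
have E0 : ptgt (PPath H) = psrc (PPath L) by [].
by have /pcong_eqv := pcong_comp E0 E' K M; apply.
Qed.

Lemma eqv_cons x y s s' : relF x y -> eqv y s s' -> eqv x (y :: s) (y :: s').
Proof.
move=> /relFbP H K; apply: (@eqv_comp x [:: y] [:: y]) => //.
by apply: eqv_refl; rewrite /= H.
Qed.

Lemma eqv_cat x s s' r :
  eqv x s s' -> path relFb (last x s) r -> eqv x (s ++ r) (s' ++ r).
Proof. by move=> H K; apply: eqv_comp => //; apply: eqv_refl. Qed.

Lemma eqv_dup x : eqv x [:: x] [::].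
Proof. exact/(pcong_eqv (c := pdup x) (d := pid x) erefl)/pcong_dup. Qed.

Lemma eqv_bounce x y : relF x y -> eqv x [:: y; x] [::].
Proof.
move=> H.
exact/(pcong_eqv (c := pbounce H) (d := pid x) erefl)/pcong_bounce.
Qed.

Lemma eqv_link p e f : linked p e f -> eqv e [:: e \th_p; f] [:: f \th_p; f].
Proof.
move=> H.
exact/(pcong_eqv (c := plambda H) (d := prho H) erefl)/pcong_link.
Qed.

Lemma pcong_mul c c' d d' :
  pcong c c' -> pcong d d' -> pcong (pmul c d) (pmul c' d').
Proof.
move=> Hc Hd.
have [Ec1 Ec2] := pcong_ends Hc; have [Ed1 Ed2] := pcong_ends Hd.
have HL : pcong (pmulL c d) (pmulL c' d').
  by rewrite /pmulL -Ec2 -Ed1; apply/pcong_prev/pcong_restrict/pcong_prev.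
have HR : pcong (pmulR c d) (pmulR c' d').
  by rewrite /pmulR -Ec2 -Ed1; apply: pcong_restrict.
have [EL1 EL2] := pcong_ends HL; have [ER1 ER2] := pcong_ends HR.
have R := pmul_subproof c d.
apply/pcong_eqv => //; apply: eqv_comp; first by apply/pcong_eqv.
rewrite {2}/pseq -ER1; apply: eqv_cons => //; exact/pcong_eqv.
Qed.

Lemma scanl_head y x s : scanl thr (y \th_x) (x :: s) = scanl thr y (x :: s).
Proof. by rewrite /= /thr thK. Qed.

Lemma scanl_scanl y z s :
  y \th_z = y -> scanl thr y (scanl thr z s) = scanl thr y s.
Proof.
elim: s y z => //= a s IH y z yz.
have E : y \th_a \th_z \th_a = y \th_a by rewrite -yz th4.
rewrite /thr -thcomp E IH //; by rewrite -thcomp thK E.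
Qed.

Lemma thr_adj z t s :
  z \th_(foldl thr t s) = foldl thr (foldl thr z (rev s) \th_t) s.
Proof.
elim: s t => //= a s IH t.
by rewrite IH rev_cons foldl_rcons /thr thcomp.
Qed.

Lemma foldl_last t a s :
  foldl thr t (a :: s) \th_(last a s) = foldl thr t (a :: s).
Proof. by rewrite lastI foldl_rcons /thr thK. Qed.

Lemma scanl_cons_head y x s : exists l, scanl thr y (x :: s) = y \th_x :: l.
Proof. by exists (scanl thr (y \th_x) s). Qed.

Lemma rev_last a s : exists l, rev (a :: s) = last a s :: l.
Proof. by exists (rev (belast a s)); rewrite lastI rev_rcons. Qed.

Lemma rev_scanl t a s :
  exists l, rev (scanl thr t (a :: s)) = foldl thr t (a :: s) :: l.
Proof.
by have [l] := rev_last (thr t a) (scanl thr (thr t a) s);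
  rewrite last_scanl; exists l.
Qed.

Lemma scanl_back t a s : path relFb a s ->
  scanl thr (foldl thr t (a :: s)) (rev (a :: s)) = rev (scanl thr t (a :: s)).
Proof.
elim/last_ind: s => [|s b IH]; first by rewrite /= /thr thK.
rewrite rcons_path => /andP[/IH{}IH /relFbP[E1 E2]].
rewrite -rcons_cons scanl_rcons !rev_rcons foldl_rcons -IH.
have [l El] := rev_last a s.
set u := foldl thr t (a :: s).
have uc : u \th_(last a s) = u by apply: foldl_last.
have ubc : thr u b \th_(last a s) = u by rewrite /thr -{1}uc thcomp -E1.
have H v r : scanl thr v (b :: r) = thr v b :: scanl thr (thr v b) r by [].
by rewrite H [thr (thr u b) b]thK El -scanl_head ubc.
Qed.

Lemma scanl_rev_scanl y t a s : path relFb a s ->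
  y \th_(foldl thr t (a :: s)) = y ->
  scanl thr y (rev (scanl thr t (a :: s))) = scanl thr y (rev (a :: s)).
Proof.
elim/last_ind: s y => [|s b IH] y.
  by move=> _ /= yt; rewrite /thr in yt *; rewrite yt -yt -thcomp !thK.
rewrite rcons_path => /andP[Hs /relFbP[E1 E2]].
rewrite -rcons_cons scanl_rcons !rev_rcons foldl_rcons.
set u := foldl thr t (a :: s) => yu.
have uc : u \th_(last a s) = u by apply: foldl_last.
have yb : y \th_b = y by rewrite -yu /thr -thcomp thK.
have Hu z : z \th_u = z \th_(last a s) \th_u \th_(last a s).
  by rewrite thcomp uc.
have Hc z : z \th_(last a s) \th_b \th_(last a s) = z \th_(last a s).
  by rewrite thcomp -E1.
have yuc : y \th_(last a s) = y \th_u.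
  by rewrite -[in LHS]yu -thcomp Hu Hc -Hu yb.
have H x v r : scanl thr v (x :: r) = v \th_x :: scanl thr (v \th_x) r by [].
rewrite !H yu yb; congr cons.
have [l El] := rev_scanl t a s; have [l' El'] := rev_last a s.
rewrite El -scanl_head -El -/u IH ?thK //.
by rewrite El' -yuc scanl_head.
Qed.

Lemma scanl_path a s : path relFb a s -> scanl thr a (a :: s) = a :: s.
Proof.
rewrite /= /thr thxx => H; congr cons; elim: s a H => //= b s IH a.
by move=> /andP[/relFbP[_ E] /IH]; rewrite /thr -E => ->.
Qed.

Lemma pseq_pmul c d :
  pseq (pmul c d) =
  rev (scanl thr (psrc d) (rev (pseq c))) ++ scanl thr (ptgt c) (pseq d).
Proof.
have -> : pseq (pmul c d) = pseq (pmulL c d) ++ pseq (pmulR c d) by [].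
rewrite pseq_prev !pseq_restrict -[in RHS]pseq_prev /pseq.
by rewrite !scanl_head.
Qed.

Lemma psrc_pmul c d : psrc (pmul c d) = foldl thr (psrc d) (rev (pseq c)).
Proof.
rewrite [LHS](_ : _ = psrc (pmulL c d)) // [LHS]ptgt_restrict -pseq_prev.
by rewrite /pseq /= /thr thK.
Qed.

Lemma ptgt_pmul c d : ptgt (pmul c d) = foldl thr (ptgt c) (pseq d).
Proof.
have [l El] := scanl_cons_head (ptgt c) (psrc d) (prest d).
rewrite (ptgtE _ (ptgt c)) pseq_pmul /pseq El last_cat -[RHS]last_scanl El.
by [].
Qed.

Lemma linked_path s e f :
  f = foldl thr e s \th_f -> e = foldl thr f (rev s) \th_e ->
  eqv e (rcons (scanl thr e s) f) (rcons (rev (scanl thr f (rev s))) f).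
Proof.
elim: s e => [|a s IH] e /= Ef Ee.
  by apply: eqv_refl; rewrite /= andbT; apply/relFbP.
set g := thr e a in Ef *; set h := foldl thr f (rev s).
have Ee' : e = h \th_a \th_e.
  by rewrite {1}Ee rev_cons foldl_rcons.
have gh : g = h \th_g by rewrite /g /thr -thcomp -Ee'.
have hg : h = g \th_h by rewrite /h thr_adj revK -Ef.
have L : linked a e h by split.
have K := IH g Ef gh.
pose tl := rev (belast f (scanl thr f (rev s))).
have Etl : rcons (rev (scanl thr f (rev s))) f = h :: tl.
  by rewrite -rev_cons lastI rev_rcons last_scanl.
have -> : rcons (rev (scanl thr f (rev (a :: s)))) f = h \th_a :: h :: tl.
  by rewrite -Etl rev_cons scanl_rcons rev_rcons foldl_rcons.
rewrite Etl in K.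
apply: eqv_trans (eqv_cons _ K) _; first by case: (linked_relF L).
apply: (eqv_cat (eqv_link L)).
by have [_ [H' _]] := K; case/andP: H'.
Qed.

Lemma pcong_mid c c' x s m m' f r :
  pseq c = (x :: s) ++ m ++ f :: r -> pseq c' = (x :: s) ++ m' ++ f :: r ->
  eqv (last x s) (rcons m f) (rcons m' f) -> pcong c c'.
Proof.
move=> [E1 E2] [E1' E2'] K.
apply/pcong_eqv; first by rewrite E1.
have := ppathP c; rewrite E1 E2 E2' -!cat_rcons cat_path => /andP[H1].
rewrite cat_path => /andP[H2 H3].
by apply: eqv_comp; [apply: eqv_refl | apply: eqv_cat].
Qed.

Lemma prevK : involutive prev.
Proof. by move=> c; apply: pseq_inj; rewrite !pseq_prev revK. Qed.

Lemma prev_mul c d : prev (pmul c d) = pmul (prev d) (prev c).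
Proof.
apply: pseq_inj; rewrite pseq_prev !pseq_pmul !pseq_prev rev_cat !revK.
by rewrite ptgt_prev.
Qed.

Lemma pseq_pmul3 c d g (v := foldl thr (ptgt c) (pseq d))
    (w := foldl thr (psrc g) (rev (pseq d))) :
  pseq (pmul (pmul c d) g) =
  rev (scanl thr w (rev (pseq c))) ++
  scanl thr (w \th_(ptgt c)) (pseq d) ++ scanl thr v (pseq g).
Proof.
set e0 := w \th_(ptgt c); set r := psrc g; set p := ptgt c.
have wd : w \th_(psrc d) = w by rewrite -ptgt_prev /w -pseq_prev foldl_ptgt.
have M : scanl thr r (rev (scanl thr p (pseq d))) =
         rev (scanl thr e0 (pseq d)).
  have [l El] := rev_scanl p (psrc d) (prest d).
  rewrite El -scanl_head -El scanl_rev_scanl ?thK ?ppathP //.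
  by rewrite -scanl_back ?ppathP // thr_adj.
rewrite pseq_pmul ptgt_pmul catA; congr (_ ++ _).
rewrite pseq_pmul rev_cat revK scanl_cat rev_cat -/p -/r M revK.
congr (rev _ ++ _).
rewrite -last_scanl M.
have -> : last r (rev (scanl thr e0 (pseq d))) = e0 \th_(psrc d).
  by rewrite /pseq /= rev_cons last_rcons.
rewrite scanl_scanl ?thK // -pseq_prev /pseq -scanl_head -[RHS]scanl_head.
have -> : psrc (prev c) = p by [].
by rewrite /e0 -[in LHS]wd -/p th4 wd.
Qed.

Lemma pmulA c d g : pcong (pmul c (pmul d g)) (pmul (pmul c d) g).
Proof.
pose v := foldl thr (ptgt c) (pseq d).
pose w := foldl thr (psrc g) (rev (pseq d)).
have E1 : pseq (pmul (pmul c d) g) =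
    rev (scanl thr w (rev (pseq c))) ++
    scanl thr (w \th_(ptgt c)) (pseq d) ++ scanl thr v (pseq g).
  exact: pseq_pmul3.
have E2 : pseq (pmul c (pmul d g)) =
    rev (scanl thr w (rev (pseq c))) ++
    rev (scanl thr (v \th_(psrc g)) (rev (pseq d))) ++ scanl thr v (pseq g).
  rewrite -[pmul c _]prevK prev_mul [prev (pmul d g)]prev_mul pseq_prev.
  rewrite pseq_pmul3 !rev_cat !pseq_prev.
  by rewrite !revK catA ptgt_prev.
have Hx : exists s, rev (scanl thr w (rev (pseq c))) = foldl thr w (rev (pseq c)) :: s.
  rewrite -pseq_prev; have [s Es] := rev_scanl w (ptgt c) (prest (prev c)).
  by exists s.
have [s Es] := Hx.
have Hl : last (foldl thr w (rev (pseq c))) s = w \th_(ptgt c).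
  by rewrite -(last_cons w) -Es -pseq_prev /= rev_cons last_rcons.
have Ev : scanl thr v (pseq g) = v \th_(psrc g) :: scanl thr (v \th_(psrc g)) (prest g).
  by [].
rewrite Es Ev in E1 E2.
apply: pcong_mid E2 E1 _; apply: eqv_sym; rewrite Hl; apply: linked_path.
- by rewrite -thr_adj -/v -thcomp !thswap.
- have -> : foldl thr (v \th_(psrc g)) (rev (pseq d)) = ptgt c \th_w.
    by rewrite thr_adj revK.
  by rewrite -thcomp !thswap.
Qed.

Lemma scanl_pseq c : scanl thr (psrc c) (pseq c) = pseq c.
Proof. exact/scanl_path/ppathP. Qed.

Lemma eqv_fold x s : path relFb x s -> eqv x (s ++ rev (x :: s)) [::].
Proof.
elim: s x => [|y s IH] x; first by move=> _; apply: eqv_dup.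
move=> /= /andP[/relFbP xy /IH K].
rewrite rev_cons -rcons_cat -cats1.
have B := eqv_bounce xy.
apply: eqv_trans B; apply: (@eqv_cat x (y :: _) [:: y]).
  exact: eqv_cons.
rewrite /= last_cat rev_cons last_rcons /= andbT; exact/relFbP/relF_sym.
Qed.

Lemma pmul_prev_mul c : pcong (pmul (pmul c (prev c)) c) c.
Proof.
have E : pseq (pmul c (prev c)) = pseq c ++ rev (pseq c).
  rewrite pseq_pmul -!pseq_prev -[ptgt c]/(psrc (prev c)).
  by rewrite !scanl_pseq pseq_prev revK.
have T : ptgt (pmul c (prev c)) = psrc c.
  by rewrite (ptgtE _ (psrc c)) E last_cat rev_cons last_rcons.
have S : psrc (pmul c (prev c)) = psrc c by case: E.
have R : pseq (pmul (pmul c (prev c)) c) = pseq c ++ rev (pseq c) ++ pseq c.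
  rewrite pseq_pmul T scanl_pseq -pseq_prev.
  have -> : psrc c = psrc (prev (pmul c (prev c))) by rewrite -T.
  by rewrite scanl_pseq pseq_prev revK E catA.
have [R1 R2] : psrc (pmul (pmul c (prev c)) c) = psrc c /\
    prest (pmul (pmul c (prev c)) c) = (prest c ++ rev (pseq c)) ++ pseq c.
  by rewrite -catA; case: R.
apply/(pcong_eqv R1); rewrite R1 R2.
have D : eqv (psrc c) (pseq c) (prest c).
  exact: (eqv_cat (eqv_dup (psrc c)) (ppathP c)).
apply: eqv_trans (D); apply: (@eqv_cat _ _ [::] (pseq c)); first exact/eqv_fold/ppathP.
by have [H _] := D; rewrite last_cat rev_cons last_rcons.
Qed.

Definition pcongb : rel ppath := fun c d => `[< pcong c d >].

Lemma pcongbP c d : reflect (pcong c d) (pcongb c d).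
Proof. exact: asboolP. Qed.

Lemma pcongb_refl : reflexive pcongb.
Proof. by move=> c; apply/pcongbP/pcong_refl. Qed.
Lemma pcongb_sym : symmetric pcongb.
Proof. by move=> c d; apply/pcongbP/pcongbP => /pcong_sym. Qed.
Lemma pcongb_trans : transitive pcongb.
Proof.
by move=> d c g /pcongbP H /pcongbP K; apply/pcongbP/(pcong_trans H).
Qed.

Canonical pcong_equiv := EquivRel pcongb pcongb_refl pcongb_sym pcongb_trans.

End Paths.

HB.instance Definition _ (P : projAlgType) := gen_eqMixin (ppath P).
HB.instance Definition _ (P : projAlgType) := gen_choiceMixin (ppath P).

Definition PG (P : projAlgType) := {eq_quot (@pcong_equiv P)}.
HB.instance Definition _ (P : projAlgType) := Choice.on (PG P).
HB.instance Definition _ (P : projAlgType) := EqQuotient.on (PG P).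

Section ChainSemigroup.
Variable P : projAlgType.

Lemma piPGP (c d : ppath P) : \pi_(PG P) c = \pi_(PG P) d <-> pcong c d.
Proof. by split => [/eqmodP/pcongbP | /pcongbP/eqmodP]. Qed.

Definition PGmul : PG P -> PG P -> PG P := lift_op2 (PG P) (@pmul P).
Definition PGstar : PG P -> PG P := lift_op1 (PG P) (@prev P).

Lemma PGmulE c d : PGmul (\pi_(PG P) c) (\pi_(PG P) d) = \pi_(PG P) (pmul c d).
Proof.
rewrite /PGmul -lock; apply/piPGP/pcong_mul; apply/piPGP; exact: reprK.
Qed.

Lemma PGstarE c : PGstar (\pi_(PG P) c) = \pi_(PG P) (prev c).
Proof.
rewrite /PGstar -lock; apply/piPGP/pcong_prev; apply/piPGP; exact: reprK.
Qed.

Lemma PGmulA : associative PGmul.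
Proof.
elim/quotW => c; elim/quotW => d; elim/quotW => g.
by rewrite !PGmulE; apply/piPGP/pmulA.
Qed.
HB.instance Definition _ := isSemigroup.Build (PG P) PGmulA.

Lemma PGstarK : involutive PGstar.
Proof. by elim/quotW => c; rewrite !PGstarE prevK. Qed.

Lemma PGstarM (a b : PG P) : PGstar (a * b) = PGstar b * PGstar a.
Proof.
elim/quotW: a => c; elim/quotW: b => d.
by rewrite [_ * _]PGmulE !PGstarE [RHS]PGmulE prev_mul.
Qed.

Lemma PGmul_star_mul (a : PG P) : a * PGstar a * a = a.
Proof.
elim/quotW: a => c; rewrite PGstarE [_ * \pi_(PG P) (prev c)]PGmulE [LHS]PGmulE.
by apply/piPGP/pmul_prev_mul.
Qed.
HB.instance Definition _ :=
  Semigroup_isRegularStar.Build (PG P) PGstarK PGstarM PGmul_star_mul.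

(* The embedding p |-> [[p]] identifying P with a subset of PG(P). *)
Definition PGproj (p : P) : PG P := \pi_(PG P) (pid p).

Lemma PGproj_inj : injective PGproj.
Proof. by move=> p q /piPGP/pcong_ends[]. Qed.

End ChainSemigroup.

(* phi extends to psi once P and P' are embedded by [PGproj]. *)
Definition lifts (P P' : projAlgType) (phi : P -> P') (psi : PG P -> PG P') :
  Prop := star_hom psi /\ forall p : P, psi (PGproj p) = PGproj (phi p).

(* Main.v *)
From mathcomp Require Import all_boot.
From mathcomp Require Import boolp.
Require Import Defs.

(** A projection algebra and its chain semigroup determine each other: the
    elements [x * star x] of [PG P] are exactly the [PGproj p], these generate
    [PG P], and their products encode the operations [theta].

    Existence: [phi] acts entrywise on [P]-paths. Every ingredient of the
    chain semigroup (the relation [relF], the generating pairs of the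
    congruence, the restriction of a path, the product, the reversal) is an
    equation or a term in the operations [theta], so the entrywise action
    respects all of it and descends to the quotient ([PGmap_star_hom]).

    Uniqueness: appending an entry to a path is multiplication by the
    corresponding projection ([pmul_pid]), so a reduced chain is the product of
    its entries and a homomorphism is determined on the projections
    ([mul_morph_ext]).

    Every homomorphism is a lift: for a reduced chain [x] starting at [p] one
    has [x * star x = PGproj p] ([PGmul_starE]). In particular this holds for
    [x = PGproj p], so any homomorphism sends [PGproj p] to some [y * star y],
    which is again of the form [PGproj p']; this defines [phi]. Moreover
    [PGproj (p \th_q)] is [x * star x] for [x = PGproj q * PGproj p]
    ([PGproj_theta]), whence [phi] is a morphism. *)

Set Implicit Arguments.
Unset Strict Implicit.
Unset Printing Implicit Defensive.

Local Open Scope group_scope.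
Local Open Scope quotient_scope.

Section Projections.
Variable P : projAlgType.
Implicit Types (p q : P) (c : ppath P).

Lemma pi_mul c d : \pi_(PG P) c * \pi_(PG P) d = \pi_(PG P) (pmul c d).
Proof. exact: PGmulE. Qed.

Lemma pi_star c : star (\pi_(PG P) c) = \pi_(PG P) (prev c).
Proof. exact: PGstarE. Qed.

(** The two factors already agree at the seam, so nothing is restricted and the
    product is the concatenation of [c] with its reversal, which folds up to
    its first entry: [(p, p) = (p)] in the middle, then [(p, q, p) = (p)]
    repeatedly. *)
Lemma PGmul_starE c :
  \pi_(PG P) c * star (\pi_(PG P) c) = PGproj (psrc c).
Proof.
rewrite pi_star pi_mul; apply/piPGP.
have E : pseq (pmul c (prev c)) = pseq c ++ rev (pseq c).
  rewrite pseq_pmul -!pseq_prev -[ptgt c]/(psrc (prev c)).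
  by rewrite !scanl_pseq pseq_prev revK.
have [E1 E2] : psrc (pmul c (prev c)) = psrc c /\
    prest (pmul c (prev c)) = prest c ++ rev (pseq c) by case: E.
apply/pcong_eqv; first by rewrite E1.
by rewrite E1 E2; apply/eqv_fold/ppathP.
Qed.

(** The semigroup thus knows [theta]: in the usual terms, this is
    [p \th_q = q p q]. *)
Lemma PGproj_theta p q :
  PGproj (p \th_q) = (PGproj q * PGproj p) * star (PGproj q * PGproj p).
Proof. by rewrite [PGproj q * _]pi_mul PGmul_starE psrc_pmul. Qed.

Lemma PGproj_mul_star p : PGproj p * star (PGproj p) = PGproj p.
Proof. exact: PGmul_starE. Qed.

(** The relation between [ptgt c] and [q] says that each is sent to the other:
    [q \th_(ptgt c) = ptgt c] and [ptgt c \th_q = q]. So neither factor changes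
    in the product. *)
Lemma pmul_pid c q :
  relF (ptgt c) q -> pseq (pmul c (pid q)) = rcons (pseq c) q.
Proof.
move=> [E1 E2]; rewrite pseq_pmul -pseq_prev.
have -> : scanl (@thr P) q (pseq (prev c)) = pseq (prev c).
  have H : thr q (ptgt c) = thr (ptgt c) (ptgt c) by rewrite /thr -E1 thxx.
  by rewrite -[RHS]scanl_pseq /pseq /= H.
by rewrite pseq_prev revK /= /thr -E2 cats1.
Qed.

(** Projections generate: peel off the last entry of a path. *)
Lemma mul_morph_ext (S : semigroupType) (f g : PG P -> S) :
  {morph f : x y / x * y} -> {morph g : x y / x * y} ->
  (forall p, f (PGproj p) = g (PGproj p)) -> f = g.
Proof.
move=> fM gM fg; apply/funext; elim/quotW => -[p s Hs].
elim/last_ind: s Hs => [|s q IH] Hs.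
  have -> : PPath Hs = pid p by apply: pseq_inj.
  exact: fg.
have := Hs; rewrite rcons_path => /andP[H /relFbP lq].
have -> : PPath Hs = pmul (PPath H) (pid q).
  by apply: pseq_inj; rewrite pmul_pid.
by rewrite -pi_mul fM gM IH -/(PGproj q) fg.
Qed.

End Projections.

Section InducedMap.
Variables (P P' : projAlgType) (phi : P -> P').
Hypothesis phiM : proj_morphism phi.
Implicit Types (p q : P) (c d : ppath P).

Lemma proj_morphism_relF p q : relF p q -> relF (phi p) (phi q).
Proof. by case=> E1 E2; split; rewrite /leF -phiM -?E1 -?E2. Qed.

Lemma proj_morphism_linked p e f :
  linked p e f -> linked (phi p) (phi e) (phi f).
Proof. by case=> E1 E2; split; rewrite -!phiM -?E1 -?E2. Qed.

Lemma ppmap_subproof c : path (@relFb P') (phi (psrc c)) (map phi (prest c)).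
Proof.
apply: homo_path (ppathP c) => p q /relFbP H.
exact/relFbP/proj_morphism_relF.
Qed.
Definition ppmap c : ppath P' := PPath (ppmap_subproof c).

Lemma pseq_ppmap c : pseq (ppmap c) = map phi (pseq c).
Proof. by []. Qed.

Lemma ptgt_ppmap c : ptgt (ppmap c) = phi (ptgt c).
Proof. exact: last_map. Qed.

Lemma map_scanl t s :
  map phi (scanl (@thr P) t s) = scanl (@thr P') (phi t) (map phi s).
Proof. by elim: s t => //= a s IH t; rewrite IH {1 2}/thr phiM. Qed.

Lemma ppmap_mul c d : ppmap (pmul c d) = pmul (ppmap c) (ppmap d).
Proof.
apply: pseq_inj; rewrite pseq_ppmap !pseq_pmul map_cat map_rev !map_scanl map_rev.
by rewrite ptgt_ppmap.
Qed.

Lemma ppmap_prev c : ppmap (prev c) = prev (ppmap c).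
Proof. by apply: pseq_inj; rewrite pseq_ppmap !pseq_prev map_rev. Qed.

Lemma pcong_ppmap c d : pcong c d -> pcong (ppmap c) (ppmap d).
Proof.
elim=> {c d}.
- by move=> p; apply: pcong_eq (pcong_dup (phi p)).
- by move=> p q H; apply: pcong_eq (pcong_bounce (proj_morphism_relF H)).
- move=> p e f H; apply: pcong_eq (pcong_link (proj_morphism_linked H)).
  + by rewrite pseq_ppmap /pseq /= phiM.
  + by rewrite pseq_ppmap /pseq /= phiM.
- by move=> c; apply: pcong_refl.
- by move=> c d _; apply: pcong_sym.
- by move=> c d g _ H1 _; apply: pcong_trans H1.
- move=> c c' d d' E E' _ Hc _ Hd.
  have F c0 d0 : ptgt c0 = psrc d0 -> ptgt (ppmap c0) = psrc (ppmap d0).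
    by move=> E0; rewrite ptgt_ppmap E0.
  apply: pcong_eq (pcong_comp (F _ _ E) (F _ _ E') Hc Hd).
  + by rewrite pseq_ppmap !pseq_comp map_cat.
  + by rewrite pseq_ppmap !pseq_comp map_cat.
Qed.

Definition PGmap (x : PG P) : PG P' := \pi_(PG P') (ppmap (repr x)).

Lemma PGmapE c : PGmap (\pi_(PG P) c) = \pi_(PG P') (ppmap c).
Proof. by apply/piPGP/pcong_ppmap/piPGP; rewrite reprK. Qed.

Lemma PGmap_star_hom : star_hom PGmap.
Proof.
split.
- elim/quotW => c; elim/quotW => d.
  by rewrite pi_mul !PGmapE ppmap_mul -pi_mul.
- by elim/quotW => c; rewrite pi_star !PGmapE ppmap_prev -pi_star.
Qed.

Lemma PGmap_proj p : PGmap (PGproj p) = PGproj (phi p).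
Proof. by rewrite PGmapE; congr (\pi_(PG P') _); apply: pseq_inj. Qed.

End InducedMap.

Section UnderlyingMorphism.
Variables (P P' : projAlgType) (psi : PG P -> PG P').
Hypothesis psi_hom : star_hom psi.

(** Any representative of the image will do: congruent paths have the same
    first entry. *)
Definition proj_part (p : P) : P' := psrc (repr (psi (PGproj p))).

Lemma PGproj_part p : psi (PGproj p) = PGproj (proj_part p).
Proof.
have [psiM psiS] := psi_hom.
by rewrite -PGmul_starE reprK -psiS -psiM PGproj_mul_star.
Qed.

Lemma proj_part_morphism : proj_morphism proj_part.
Proof.
have [psiM psiS] := psi_hom.
move=> p q; apply: PGproj_inj.
by rewrite -PGproj_part !PGproj_theta psiM psiS psiM !PGproj_part.
Qed.

End UnderlyingMorphism.

Theorem theorem5p9 (P P' : projAlgType) :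
  (forall phi : P -> P', proj_morphism phi ->
     exists! psi : PG P -> PG P', lifts phi psi) /\
  (forall psi : PG P -> PG P', star_hom psi ->
     exists phi : P -> P', proj_morphism phi /\ lifts phi psi).
Proof.
split=> [phi phiM | psi psi_hom].
- exists (PGmap phiM); split.
    by split; [apply: PGmap_star_hom | apply: PGmap_proj].
  move=> psi [psi_hom psi_proj].
  apply: mul_morph_ext => [||p]; [exact: (PGmap_star_hom phiM).1 | exact: psi_hom.1 |].
  by rewrite psi_proj PGmap_proj.
- exists (proj_part psi); split; first exact: proj_part_morphism.
  by split=> // p; apply: PGproj_part.
Qed.
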